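(* If $G$ is the graph of a $d$-polytope $P$, and $H$ is the graph of a regular subdivision of an $e$-polytope $Q$, then the Cartesian product $G\times H$ is $(d+e)$-polytopal. In the case $d>1$, the regular subdivision of $Q$ can even have internal vertices (meaning that not only the vertices of $Q$ are lifted, but also a finite number of interior points of $Q$).
   Context: The graph of a polytope is the abstract graph formed by its vertices and edges; a $d$-polytope is a polytope of dimension $d$. A graph is $d$-polytopal if it is isomorphic to the graph of some $d$-polytope. Given an $e$-polytope $Q\subset\mathbb{R}^e$ with vertex set $V(Q)$ and a lifting function $\omega:V(Q)\to\mathbb{R}$, consider the convex hull of the lifted points $\{(q,\omega(q)) : q\in V(Q)\}\subset\mathbb{R}^{e+1}$ and its upper envelope, i.e. the set of all its upper facets with respect to the last coordinate. The regular subdivision of $Q$ defined by $\omega$ is the projection of this upper envelope to $\mathbb{R}^e$, and its graph is the graph of the upper envelope (its vertices and edges). A regular subdivision with internal vertices is obtained in the same way by lifting, in addition to the vertices of $Q$, a finite number of interior points of $Q$. The Cartesian product $G\times H$ of graphs has vertex set $V(G)\times V(H)$, and $(a,b)$, $(c,f)$ are adjacent if either $a=c$ and $\{b,f\}\in E(H)$, or $b=f$ and $\{a,c\}\in E(G)$.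
   Formalization: The dimension d of P is assumed to be at least 1; for d = 0 the claim fails, e.g. when P is a point and Q is a square subdivided by a diagonal, since the resulting graph is not 2-polytopal. *)

(* Defs.v *)
From HB Require Import structures.
From mathcomp Require Import all_boot all_order all_algebra.
From mathcomp Require Import boolp classical_sets functions cardinality reals.
From mathcomp Require Import topology normedtype convex.
Set Implicit Arguments.
Unset Strict Implicit.
Unset Printing Implicit Defensive.
Import Order.TTheory GRing.Theory Num.Theory.
Local Open Scope classical_set_scope.
Local Open Scope ring_scope.

Record sgraph := SGraph {
  vert :> finType;
  adj : rel vert;
  adj_sym : symmetric adj;
  adj_irr : irreflexive adj }.

Section CartesianProduct.
Variables G H : sgraph.

Definition cart_adj (x y : G * H) : bool :=
  ((x.1 == y.1) && adj x.2 y.2) || ((x.2 == y.2) && adj x.1 y.1).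

Lemma cart_adj_sym : symmetric cart_adj.
Proof.
move=> x y; rewrite /cart_adj (eq_sym x.1) (eq_sym x.2).
by rewrite (adj_sym x.1) (adj_sym x.2).
Qed.

Lemma cart_adj_irr : irreflexive cart_adj.
Proof. by move=> x; rewrite /cart_adj !adj_irr !andbF. Qed.

Definition cart_prod : sgraph := SGraph cart_adj_sym cart_adj_irr.
End CartesianProduct.

(* G is isomorphic to the graph with vertex set V, a set of points, and
   adjacency relation E. *)
Definition is_graph (G : sgraph) (T : Type) (V : set T) (E : T -> T -> Prop) :=
  exists f : G -> T, [/\ injective f, range f = V
    & forall x y, adj x y <-> E (f x) (f y)].

Section Polytopes.
Variables (R : realType) (n : nat).
Implicit Types (A F P : set 'rV[R]_n) (c : 'cV[R]_n) (u v : 'rV[R]_n).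

Definition convex_hull A : set 'rV[R]_n := smallest (@convex_set R _) A.

Definition affine_hull A : set 'rV[R]_n :=
  [set y | exists (m : nat) (p : 'I_m -> 'rV[R]_n) (a : 'I_m -> R),
    [/\ forall i, A (p i), \sum_i a i = 1 & y = \sum_i a i *: p i]].

(* The empty set has no dimension in this sense. *)
Definition has_dim A (k : nat) :=
  exists (v : 'rV[R]_n) (U : {vspace 'rV[R]_n}),
    \dim U = k /\ affine_hull A = [set v + u | u in [set` U]].

(* A polytope of dimension k, not necessarily full-dimensional in R^n. *)
Definition is_polytope (k : nat) P :=
  (exists2 S : set 'rV[R]_n, finite_set S & P = convex_hull S) /\ has_dim P k.

Definition maximizers A c : set 'rV[R]_n :=
  [set x | A x /\ forall y, A y -> (y *m c) 0 0 <= (x *m c) 0 0].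

(* The nonempty faces of a polytope, with the polytope itself (c = 0). *)
Definition is_face P F := exists c, F = maximizers P c.

Definition vertices P : set 'rV[R]_n := [set v | is_face P [set v]].

Definition are_joined P u v :=
  [/\ vertices P u, vertices P v, u <> v
    & exists F, [/\ is_face P F, has_dim F 1, F u & F v]].

Definition is_polytope_graph (G : sgraph) P :=
  is_graph G (vertices P) (are_joined P).

(* The graph of a family of polytopes glued along faces. *)
Definition is_complex_graph (G : sgraph) (C : set (set 'rV[R]_n)) :=
  is_graph G [set v | exists2 F, C F & vertices F v]
             (fun u v => exists2 F, C F & are_joined F u v).
End Polytopes.

Definition polytopal (R : realType) (k : nat) (G : sgraph) :=
  exists (n : nat) (P : set 'rV[R]_n), is_polytope k P /\ is_polytope_graph G P.

Section RegularSubdivisions.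
Variables (R : realType) (e : nat).
Implicit Types (W : set 'rV[R]_e) (omega : 'rV[R]_e -> R).

Definition lift_point omega (q : 'rV[R]_e) : 'rV[R]_(e + 1) :=
  row_mx q (omega q)%:M.

(* Requiring dimension e, rather than codimension 1 in A, also covers the case
   of an affine lifting function: A is then e-dimensional and is its own
   unique upper facet. *)
Definition is_upper_facet (A F : set 'rV[R]_(e + 1)) :=
  exists c : 'cV[R]_(e + 1),
    [/\ 0 < c (rshift e ord0) 0, F = maximizers A c & has_dim F e].

Definition upper_envelope W omega : set (set 'rV[R]_(e + 1)) :=
  is_upper_facet (convex_hull (lift_point omega @` W)).

(* The graph of the regular subdivision obtained by lifting the points of W.
   It is read off the envelope, which projects bijectively onto the
   subdivision. Only the values of omega on W matter, and a point of W whose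
   lifting is not a vertex of the envelope is not a vertex of the graph. *)
Definition is_regular_subdivision_graph (G : sgraph) W omega :=
  is_complex_graph G (upper_envelope W omega).
End RegularSubdivisions.

(* Main.v *)
Require Import Defs.
From mathcomp Require Import all_boot all_order all_algebra.
From mathcomp Require Import boolp classical_sets functions cardinality reals.
From mathcomp Require Import topology normedtype convex interval_inference ring lra.
Import numFieldNormedType.Exports.
Import Order.TTheory GRing.Theory Num.Theory.
Set Implicit Arguments.
Unset Strict Implicit.
Unset Printing Implicit Defensive.
Local Open Scope classical_set_scope.
Local Open Scope ring_scope.

(** Let P be the hull of a finite set A centred at its centroid x0, and let L
be the set of lifted points z = (q, omega q).  The product graph is realised by
the hull X of the points ((omega q + K) (p - x0), q), with p in A and z in L,
where the constant K makes every factor omega q + K positive ([warp]).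

A functional (a, b) takes on such a point the value
(omega q + K) a(p - x0) + b(q).  Let M be the maximum of a(p - x0) over A.  As
the factors are positive, the value is at most b(q) + M omega q + M K, so the
face of X selected by (a, b) consists of the pairs (p, z) such that p maximizes
a on A and z maximizes (b, M) on L ([maximizers_warped]).  The centroid makes M
nonnegative, and M = 0 only if a is constant on A ([centroid_ge0],
[centroid_eq0]); hence each functional that is not constant on A sees L from
above, and every upward direction occurs after rescaling ([tilted_scale]).

Vertices of X are therefore the pairs of a vertex of P and a vertex of the
envelope ([warped_exposed]).  An edge of X cannot move both coordinates, for
the corresponding face would contain the four corners of a nondegenerate
quadrangle; conversely an edge of the envelope over a vertex of P, and a proper
edge of P over a vertex of the envelope, are cut out by M > 0
([warped_edge]).  The one remaining case is that P itself is a segment: then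
the edge over z needs M = 0, that is a linear functional on Q that singles out
the base point of z.  It exists if all the lifted points lie over vertices of
Q, and this is why internal vertices ask for d > 1.

The envelope graph is defined from upper facets, while the argument uses faces
selected by upward functionals.  The two agree because an upper face extends to
an upper facet by tilting the functional until it hits further points
([spanning_face]), and because a face of a face is selected by a small
perturbation ([perturb]).  Tilting never gets stuck since the vertices of Q
already span the ambient space affinely ([const_on_vertices_eq0]). *)

(** * Functionals, maximizers and convex hulls *)

Section Hulls.
Variables (R : realType) (n : nat).
Implicit Types (A B S : set 'rV[R]_n) (c : 'cV[R]_n) (u v x : 'rV[R]_n).
Implicit Type U : {vspace 'rV[R]_n}.

Definition ev c x : R := (x *m c) 0 0.

Lemma evD c x y : ev c (x + y) = ev c x + ev c y.
Proof. by rewrite /ev mulmxDl mxE. Qed.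
Lemma evZ c a x : ev c (a *: x) = a * ev c x.
Proof. by rewrite /ev -scalemxAl mxE. Qed.
Lemma evB c x y : ev c (x - y) = ev c x - ev c y.
Proof. by rewrite /ev mulmxBl !mxE. Qed.
Lemma ev_sum c I (r : seq I) (F : I -> 'rV[R]_n) :
  ev c (\sum_(i <- r) F i) = \sum_(i <- r) ev c (F i).
Proof. by rewrite /ev mulmx_suml summxE. Qed.
Lemma evDl c c' x : ev (c + c') x = ev c x + ev c' x.
Proof. by rewrite /ev mulmxDr mxE. Qed.
Lemma evZl c a x : ev (a *: c) x = a * ev c x.
Proof. by rewrite /ev -scalemxAr mxE. Qed.
Lemma evNl c x : ev (- c) x = - ev c x.
Proof. by rewrite /ev mulmxN mxE. Qed.
Lemma ev0 c : ev c 0 = 0.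
Proof. by rewrite /ev mul0mx mxE. Qed.

Lemma maximizers_eq A c x y :
  maximizers A c x -> maximizers A c y -> ev c x = ev c y.
Proof. by move=> [Ax hx] [Ay hy]; apply/le_anti; rewrite hx ?hy. Qed.

Lemma maximizers_ev A c x y :
  maximizers A c x -> A y -> ev c y = ev c x -> maximizers A c y.
Proof. by move=> [Ax hx] Ay e; split=> // z Az; rewrite -!/(ev _ _) e; apply: hx. Qed.

Lemma maximizers_subset A B c x :
  A `<=` B -> maximizers B c x -> A x -> maximizers A c = maximizers B c `&` A.
Proof.
move=> AB Bx Ax; apply/seteqP; split=> y.
  move=> [Ay hy]; split=> //; apply: (maximizers_ev Bx (AB _ Ay)).
  by apply/le_anti; rewrite (hy _ Ax) andbT; apply: Bx.2; apply: AB.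
by move=> [[By hy] Ay]; split=> // z Az; apply: hy; apply: AB.
Qed.

Lemma maximizersZ A c (a : R) : 0 < a -> maximizers A (a *: c) = maximizers A c.
Proof.
move=> a0; apply/seteqP; split=> x [Ax hx]; split=> // y Ay; have := hx y Ay;
  by rewrite -!/(ev _ _) !evZl ler_pM2l.
Qed.

Lemma convex_setP A : convex_set (A : set (convex_lmodType 'rV[R]_n)) <->
  forall x y (k : R), 0 < k -> k < 1 -> A x -> A y -> A (k *: x + (1 - k) *: y).
Proof.
split=> [h x y k k0 k1 Ax Ay|h].
  have := h x y (Itv01 (ltW k0) (ltW k1)); rewrite !inE; exact.
apply/convex_setW => x y xA yA k k0 k1.
by move: xA yA; rewrite !inE => Ax Ay; exact: h.
Qed.

Lemma hull_convex A : convex_set (convex_hull A : set (convex_lmodType 'rV[R]_n)).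
Proof.
apply/convex_setP => x y k k0 k1 hx hy C [cC AC].
by move/convex_setP: (cC); apply => //; [apply: hx|apply: hy].
Qed.

Lemma sub_hull A : A `<=` convex_hull A.
Proof. exact: sub_gen_smallest. Qed.

Lemma hull_sub A B :
  convex_set (B : set (convex_lmodType 'rV[R]_n)) -> A `<=` B ->
  convex_hull A `<=` B.
Proof. by move=> cB AB; apply: smallest_sub. Qed.

Lemma hull_mono A B : A `<=` B -> convex_hull A `<=` convex_hull B.
Proof.
move=> AB; apply: hull_sub; first exact: hull_convex.
by apply: subset_trans AB _; exact: sub_hull.
Qed.

(** The points where the functional stays below its maximum, together with the
hull of the maximizers in A, form a convex set that contains A; this gives the
inclusion from left to right without writing out convex combinations. *)
Lemma maximizers_hull A c :
  maximizers (convex_hull A) c = convex_hull (maximizers A c).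
Proof.
apply/seteqP; split=> x.
  move=> [hx mx].
  (* ev c x is the maximum over the whole hull *)
  pose C := [set y | ev c y < ev c x \/
                     ev c y = ev c x /\ convex_hull (maximizers A c) y].
  suff : C x by rewrite /C /= ltxx; case=> // -[].
  apply: hx; split; last first.
    move=> a Aa; have := mx _ (sub_hull Aa); rewrite -!/(ev _ _).
    rewrite le_eqVlt => /orP[/eqP e|]; [right|by left].
    split=> //; apply: sub_hull; split=> // b Ab.
    by rewrite -!/(ev _ _) e; apply: mx; exact: sub_hull.
  apply/convex_setP => y z k k0 k1; rewrite /C /= evD !evZ.
  case=> [hy|[ey hy]] [hz|[ez hz]].
  - by left; nra.
  - by left; nra.
  - by left; nra.
  - right; split; first by rewrite ey ez; lra.
    by have /convex_setP := @hull_convex (maximizers A c); apply.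
have hle y : convex_hull (maximizers A c) y ->
    forall a, A a -> ev c a <= ev c y.
  move=> hy a Aa; apply: (@hull_sub (maximizers A c) [set y | ev c a <= ev c y]) hy.
    apply/convex_setP => u v k k0 k1 /=; rewrite evD !evZ; nra.
  by move=> b [Ab]; apply.
move=> hx; split.
  by apply: hull_mono hx => a [].
move=> y hy; rewrite -!/(ev _ _).
apply: (@hull_sub A [set y | ev c y <= ev c x]) hy.
  apply/convex_setP => u v k k0 k1 /=; rewrite evD !evZ; nra.
by move=> a Aa; exact: hle.
Qed.

(** * Flats, lines and dimension *)

(** Flats are described by membership of a difference, so that inclusions
between them reduce to linear algebra. *)
Definition flat v U : set 'rV[R]_n := [set x | x - v \in U].

Lemma flatE v U : flat v U = [set v + u | u in [set` U]].
Proof.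
apply/seteqP; split=> x /=; first by move=> h; exists (x - v) => //; rewrite addrC subrK.
by case=> u uU <-; rewrite /flat /= addrC addKr.
Qed.

Lemma flat_base v U : flat v U v.
Proof. by rewrite /flat /= subrr mem0v. Qed.

Lemma flat_convex v U : convex_set (flat v U : set (convex_lmodType 'rV[R]_n)).
Proof.
apply/convex_setP => x y k _ _; rewrite /flat /= => hx hy.
have -> : k *: x + (1 - k) *: y - v = k *: (x - v) + (1 - k) *: (y - v).
  rewrite !scalerBr addrACA -opprD -scalerDl addrCA subrr addr0 scale1r //.
by rewrite rpredD ?rpredZ.
Qed.

Lemma flat_inj v U v' U' : flat v U = flat v' U' -> U = U'.
Proof.
suff main w1 (V1 : {vspace _}) w2 V2 :
    flat w1 V1 `<=` flat w2 V2 -> (V1 <= V2)%VS.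
  move=> e; apply/eqP; rewrite eqEsubv.
  by apply/andP; split; [apply: (main v _ v')|apply: (main v' _ v)]; rewrite e.
move=> sub; apply/subvP => u uV.
have h1 := sub _ (flat_base w1 V1).
have h2 : flat w2 V2 (w1 + u) by apply: sub; rewrite /flat /= addrC addKr.
by have := rpredB h2 h1; rewrite /= opprB addrA subrK addrC addKr.
Qed.

Lemma sub_affine_hull A : A `<=` affine_hull A.
Proof.
move=> x Ax; exists 1%N, (fun=> x), (fun=> 1); split=> //.
  by rewrite big_ord1.
by rewrite big_ord1 scale1r.
Qed.

Lemma affine_hull_sub A v U : A `<=` flat v U -> affine_hull A `<=` flat v U.
Proof.
move=> AU y [m [p [a [Ap a1 ->]]]]; rewrite /flat /=.
rewrite -[v]scale1r -a1 scaler_suml -sumrB rpred_sum // => i _.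
by rewrite -scalerBr rpredZ //; apply: AU.
Qed.

Lemma has_dimP A k :
  has_dim A k <-> exists v U, \dim U = k /\ affine_hull A = flat v U.
Proof. by split=> -[v [U [d e]]]; exists v, U; rewrite flatE in e *. Qed.

Definition on_line u v := flat u <[v - u]>%VS.

Lemma on_lineP u v x : on_line u v x <-> exists t, x = u + t *: (v - u).
Proof.
rewrite /on_line /flat /=; split=> [/vlineP[t e]|[t ->]].
  by exists t; rewrite -e addrC subrK.
by rewrite addrC addKr memvZ ?memv_line.
Qed.

(** Two distinct points of A already determine its only candidate for an affine
hull of dimension one. *)
Lemma has_dim1P A u v : A u -> A v -> u <> v ->
  has_dim A 1 <-> A `<=` on_line u v.
Proof.
move=> Au Av uv; have uv0 : v - u != 0 by rewrite subr_eq0 eq_sym; apply/eqP.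
split.
  case/has_dimP => w [U [dU e]] x Ax.
  have hw y : A y -> y - w \in U.
    by move=> Ay; have := sub_affine_hull Ay; rewrite e.
  have hu y : A y -> y - u \in U.
    by move=> Ay; have := rpredB (hw y Ay) (hw u Au); rewrite opprB addrA subrK.
  rewrite /on_line /flat /=; suff -> : <[v - u]>%VS = U by exact: hu.
  by apply/eqP; rewrite eqEdim -memvE hu //= dU dim_vline uv0.
move=> AL; apply/has_dimP; exists u, <[v - u]>%VS; split.
  by rewrite dim_vline uv0.
apply/seteqP; split; first exact: affine_hull_sub.
move=> _ /on_lineP[t ->].
exists 2%N, (fun i => if i == ord0 then u else v),
  (fun i => if i == ord0 then 1 - t else t); split.
- by move=> i; case: ifP.
- by rewrite big_ord_recl big_ord1 /=; lra.
- rewrite big_ord_recl big_ord1 /= scalerBl scale1r scalerBr addrA.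
  by rewrite addrAC.
Qed.

(** * Vertices and edges through functionals *)

(** For K the whole space these are the vertices and edges of the hull of S; for
K the cone of upward functionals they are those of the upper envelope. *)
Definition exposed (K : set 'cV[R]_n) S v :=
  exists2 c, K c & maximizers S c = [set v].

Definition exposed_edge (K : set 'cV[R]_n) S u v :=
  [/\ exposed K S u, exposed K S v, u <> v
    & exists c, [/\ K c, maximizers S c u, maximizers S c v
                  & maximizers S c `<=` on_line u v]].

Lemma hull_set1 v : convex_hull [set v] = [set v].
Proof.
apply/seteqP; split; last exact: sub_hull.
apply: hull_sub => //; apply/convex_setP => x y k _ _ /= -> ->.
by rewrite -scalerDl addrC subrK scale1r.
Qed.

Lemma hull_eq1 A v : convex_hull A = [set v] -> A = [set v].
Proof.
move=> e; apply/seteqP; split; first by rewrite -e; exact: sub_hull.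
move=> _ ->; have : convex_hull A v by rewrite e.
apply: contraPP => nAv hv.
suff : convex_hull A `<=` set0 by apply; exact: hv.
apply: hull_sub; first by apply/convex_setP.
by move=> a Aa; apply: nAv; have := sub_hull Aa; rewrite e => <-.
Qed.

Lemma face_hull1 A c v :
  maximizers (convex_hull A) c = [set v] <-> maximizers A c = [set v].
Proof.
rewrite maximizers_hull; split; first exact: hull_eq1.
by move=> ->; rewrite hull_set1.
Qed.

Lemma vertices_hull A v : vertices (convex_hull A) v <-> exposed setT A v.
Proof.
split; first by case=> c /esym/face_hull1 e; exists c.
by case=> c _ e; exists c; apply/esym/face_hull1.
Qed.

Lemma exposed_mem K A v : exposed K A v -> A v.
Proof.
case=> c _ e; have : maximizers A c v by rewrite e.
by case.
Qed.

(** A face of the hull that contains two vertices is one-dimensional exactly if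
the generators on it lie on the line through them, so hulls can be forgotten
from here on. *)
Lemma joined_hull A u v :
  are_joined (convex_hull A) u v <-> exposed_edge setT A u v.
Proof.
split.
  case=> /vertices_hull vu /vertices_hull vv uv [F [[c eF] dF Fu Fv]].
  split=> //; exists c; subst F; have := dF; rewrite (has_dim1P Fu Fv uv) => sL.
  have -> : maximizers A c = maximizers (convex_hull A) c `&` A.
    exact: maximizers_subset (@sub_hull A) Fu (exposed_mem vu).
  split=> //; [split=> //; exact: exposed_mem vu|split=> //; exact: exposed_mem vv|].
  by move=> x [Fx _]; exact: sL.
case=> vu vv uv [c [_ Mu Mv sL]]; split; [exact/vertices_hull..|by []|].
have Fu : maximizers (convex_hull A) c u by rewrite maximizers_hull; exact: sub_hull.
have Fv : maximizers (convex_hull A) c v by rewrite maximizers_hull; exact: sub_hull.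
exists (maximizers (convex_hull A) c); split=> //; first by exists c.
apply/(has_dim1P Fu Fv uv); rewrite maximizers_hull.
by apply: hull_sub => //; exact: flat_convex.
Qed.

(** * Dimension of the hull of a finite set *)

Definition dirs (a : 'rV[R]_n) (s : seq 'rV[R]_n) := <<[seq x - a | x <- s]>>%VS.

Lemma mem_dirs a s x : x \in s -> x - a \in dirs a s.
Proof. by move=> xs; apply: memv_span; apply: map_f. Qed.

Lemma dirs_sub a s U : (forall x, x \in s -> x - a \in U) -> (dirs a s <= U)%VS.
Proof. by move=> h; apply/span_subvP => _ /mapP[x xs ->]; exact: h. Qed.

Lemma affine_hull_hull a s : a \in s ->
  affine_hull (convex_hull [set` s]) = flat a (dirs a s).
Proof.
move=> sa; apply/seteqP; split.
  apply: affine_hull_sub; apply: hull_sub; first exact: flat_convex.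
  by move=> x /= xs; exact: mem_dirs.
move=> x hx.
pose t := map_tuple (fun y => y - a) (in_tuple s).
pose k' i : R := coord t i (x - a).
have e : x = a + \sum_i k' i *: (s`_i - a).
  rewrite addrC; apply/(canRL (subrK a)).
  rewrite [LHS](coord_span (X := t)) //; apply: eq_bigr => i _.
  by rewrite (nth_map 0).
(* a gets the coefficient that completes the sum to one *)
pose kt := [tuple k' i | i < size s].
exists (size s).+1, (fun i => (a :: s)`_i), (fun i => (1 - \sum_i k' i :: kt)`_i).
split.
- move=> i; apply: sub_hull; have : (a :: s)`_i \in a :: s by rewrite mem_nth.
  by rewrite inE => /predU1P[->|].
- rewrite big_ord_recl -[RHS](subrK (\sum_i k' i) 1); congr (_ + _).
  by apply: eq_bigr => i _; rewrite /= add0n; exact: (nth_mktuple k').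
- rewrite big_ord_recl.
  transitivity ((1 - \sum_i k' i) *: a + \sum_i k' i *: s`_i); last first.
    congr (_ + _); apply: eq_bigr => i _; rewrite /= add0n; congr (_ *: _).
    by apply/esym; exact: (nth_mktuple k').
  rewrite e; under eq_bigr do rewrite scalerBr.
  by rewrite sumrB -scaler_suml scalerBl scale1r addrA addrAC.
Qed.

Lemma has_dim_hull a s k : a \in s ->
  has_dim (convex_hull [set` s]) k <-> \dim (dirs a s) = k.
Proof.
move=> sa; rewrite has_dimP; split.
  by case=> v [U [<-]]; rewrite (affine_hull_hull sa) => /flat_inj ->.
by move=> <-; exists a, (dirs a s); rewrite -affine_hull_hull.
Qed.

End Hulls.

(** * Finite sets of points *)

Section FiniteSets.
Variables (R : realType).

Lemma count_lt (T : eqType) (p q : pred T) (s : seq T) x :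
  subpred p q -> x \in s -> q x -> ~~ p x -> (count p s < count q s)%N.
Proof.
move=> pq + qx px; elim: s => // y s IH; rewrite inE => /predU1P[<-|xs] /=.
  by rewrite qx (negPf px) add0n add1n ltnS sub_count.
rewrite -addnS leq_add ?IH //.
by case py: (p y) => //; rewrite (pq _ py).
Qed.

Lemma seq_argmax (T : eqType) (s : seq T) (f : T -> R) a : a \in s ->
  exists2 x, x \in s & forall y, y \in s -> f y <= f x.
Proof.
elim: s a => // b [|b' s] IH a _.
  by exists b; rewrite ?mem_head // => y; rewrite inE => /eqP ->.
have [x xs hx] := IH b' (mem_head _ _).
have [le|lt] := leP (f b) (f x).
  exists x; first by rewrite inE xs orbT.
  by move=> y; rewrite inE => /predU1P[->|/hx].
exists b; first exact: mem_head.
move=> y; rewrite inE => /predU1P[->//|/hx h].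
exact: le_trans h (ltW lt).
Qed.

Lemma seq_small (T : eqType) (s : seq T) (Q : T -> R -> Prop) :
  (forall x, x \in s -> exists2 r, 0 < r & forall t, 0 < t -> t <= r -> Q x t) ->
  exists2 r, 0 < r & forall t, 0 < t -> t <= r -> forall x, x \in s -> Q x t.
Proof.
elim: s => [|a s IH] h; first by exists 1.
have [r1 r10 h1] := h a (mem_head _ _).
have [x xs|r2 r20 h2] := IH; first by apply: h; rewrite inE xs orbT.
exists (Num.min r1 r2); first by rewrite lt_min r10.
move=> t t0; rewrite le_min => /andP[t1 t2] x.
rewrite inE => /predU1P[->|xs]; [exact: h1|exact: h2].
Qed.

Lemma small_coef (a b : R) : 0 < a ->
  exists2 r, 0 < r & forall t, 0 < t -> t <= r -> t * b < a.
Proof.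
move=> a0; have n0 : 0 < 1 + `|b| by rewrite ltr_wpDr.
exists (a / (1 + `|b|)); first by rewrite divr_gt0.
move=> t t0; rewrite ler_pdivlMr // => h; apply: lt_le_trans h.
by rewrite ltr_pM2l // (le_lt_trans (ler_norm b)) // ltrDr.
Qed.

Section Faces.
Variable n : nat.
Implicit Types (s : seq 'rV[R]_n) (c : 'cV[R]_n) (u v x : 'rV[R]_n).

Lemma maximizers_exists s c a : a \in s -> exists x, maximizers [set` s] c x.
Proof. by move=> /(@seq_argmax _ _ (ev c))[x xs hx]; exists x. Qed.

Definition face_seq s c := [seq x <- s | `[< maximizers [set` s] c x >]].

Lemma face_seqE s c : [set` face_seq s c] = maximizers [set` s] c.
Proof.
apply/seteqP; split=> x /=; rewrite mem_filter; first by case/andP => /asboolP.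
by move=> h; apply/andP; split; [apply/asboolP|case: h].
Qed.

Lemma ev_separates u v : u <> v -> exists c, ev c u <> ev c v.
Proof.
move=> uv; apply: contrapT => h; apply: uv; apply/rowP => j.
apply: contrapT => uj; apply: h; exists (delta_mx j 0).
by rewrite /ev -!colE !mxE.
Qed.

(** Points off the first face lose by a fixed positive amount, which a small
multiple of the second functional cannot make up; on the face only the second
functional matters. *)
Lemma perturb s c0 c1 : exists2 r, 0 < r & forall t, 0 < t -> t <= r ->
  maximizers [set` s] (c0 + t *: c1) = maximizers (maximizers [set` s] c0) c1.
Proof.
have [->|[a sa]] : s = [::] \/ exists a, a \in s.
  by case: s => [|a s]; [left|right; exists a; exact: mem_head].
  by exists 1 => // t _ _; apply/seteqP; split=> x [] // [].
have [a1] := maximizers_exists c0 sa.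
rewrite -face_seqE => /(maximizers_exists c1)[b].
rewrite face_seqE => mb.
have mb0 : maximizers [set` s] c0 b by case: mb.
have sb : b \in s by case: mb0.
have [x xs|r r0 hr] := @seq_small _ s
    (fun x t => ~ maximizers [set` s] c0 x -> t * (ev c1 x - ev c1 b) < ev c0 b - ev c0 x).
  have [mx|nmx] := pselect (maximizers [set` s] c0 x); first by exists 1.
  have lt : 0 < ev c0 b - ev c0 x.
    rewrite subr_gt0 lt_neqAle; case: (mb0) => _ /(_ x xs); rewrite -!/(ev _ _) => ->.
    rewrite andbT; apply/eqP => e; apply: nmx; exact: maximizers_ev mb0 xs e.
  have [r r0 h] := small_coef (ev c1 x - ev c1 b) lt.
  by exists r => // t t0 tr _; exact: h.
exists r => // t t0 tr; have {}hr := hr t t0 tr.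
have mbt : maximizers [set` s] (c0 + t *: c1) b.
  split=> // x xs; rewrite -!/(ev _ _) !evDl !evZl.
  have [mx|nmx] := pselect (maximizers [set` s] c0 x).
    rewrite (maximizers_eq mx mb0) lerD2l ler_pM2l //; exact: mb.2.
  by have := hr x xs nmx; rewrite mulrBr; lra.
apply/seteqP; split=> x.
  move=> mx; have := maximizers_eq mx mbt; rewrite !evDl !evZl => e.
  have xs : x \in s by case: mx.
  have [mx0|nmx] := pselect (maximizers [set` s] c0 x); last first.
    by have := hr x xs nmx; rewrite mulrBr; lra.
  apply: (maximizers_ev mb mx0); apply: (mulfI (lt0r_neq0 t0)).
  by move: e; rewrite (maximizers_eq mx0 mb0); lra.
move=> mx; apply: (maximizers_ev mbt); first by case: mx => -[].
by rewrite !evDl !evZl (maximizers_eq mx mb) (maximizers_eq mx.1 mb0).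
Qed.

(** Among the subfaces of the given face, one with the fewest points is a single
point: otherwise a functional separating two of its points cuts out a smaller
one. *)
Lemma exposed_maximizer s c a : a \in s ->
  exists2 v, exposed setT [set` s] v & maximizers [set` s] c v.
Proof.
move=> sa.
suff main k c' : (size (face_seq s c') <= k)%N ->
    maximizers [set` s] c' `<=` maximizers [set` s] c ->
    exists2 v, exposed setT [set` s] v & maximizers [set` s] c v.
  exact: (main _ c (leqnn _)).
elim: k c' => [|k IH] c' hk sub; have [x mx] := maximizers_exists c' sa.
  move: hk; rewrite leqn0 size_eq0 => /eqP e.
  by move: mx; rewrite -face_seqE e.
have [single|] := pselect (maximizers [set` s] c' `<=` [set x]).
  exists x; last exact: sub.
  by exists c' => //; apply/seteqP; split=> // _ ->.
move=> /existsNP[y /not_implyP[my yx]].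
have [c1 c1xy] := ev_separates yx.
have [r r0 /(_ r r0 (lexx _)) e] := perturb s c' c1.
apply: (IH (c' + r *: c1)); last by rewrite e => z [mz _]; exact: sub.
rewrite -ltnS (leq_trans _ hk) // !size_filter.
have [z [mz nz]] : exists z, maximizers [set` s] c' z /\
    ~ maximizers [set` s] (c' + r *: c1) z.
  rewrite e; apply: contrapT => h; apply: c1xy.
  have hz z : maximizers [set` s] c' z ->
    maximizers (maximizers [set` s] c') c1 z.
    by move=> mz; apply: contrapT => nz; apply: h; exists z.
  exact: maximizers_eq (hz _ my) (hz _ mx).
apply: (@count_lt _ _ _ _ z).
- by move=> w /asboolP; rewrite e => -[mw _]; exact/asboolP.
- by case: mz.
- exact/asboolP.
- exact/asboolP.
Qed.

(** The tilting stops at the first moment when a point on the increasing side of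
the direction d reaches the maximal value. *)
Lemma tilt s c d u z :
  maximizers [set` s] c u -> z \in s -> ev d u < ev d z ->
  (forall x, maximizers [set` s] c x -> ev d x = ev d u) ->
  exists t z1, [/\ maximizers [set` s] c `<=` maximizers [set` s] (c + t *: d),
    maximizers [set` s] (c + t *: d) z1 & ~ maximizers [set` s] c z1].
Proof.
move=> mu zs uz dc.
pose f x := (ev c x - ev c u) / (ev d x - ev d u).
have zin : z \in [seq x <- s | ev d u < ev d x] by rewrite mem_filter uz.
have [z1] := seq_argmax f zin.
rewrite mem_filter => /andP[uz1 z1s] hz1.
(* f x is minus the tilting time at which x reaches the maximal value *)
pose t := - f z1; exists t, z1.
have z1p : 0 < ev d z1 - ev d u by rewrite subr_gt0.
have t0 : 0 <= t.
  rewrite /t /f -mulNr divr_ge0 ?(ltW z1p) // opprB subr_ge0; exact: mu.2.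
have tz1 : t * (ev d z1 - ev d u) = ev c u - ev c z1.
  by rewrite /t /f -mulNr divfK ?lt0r_neq0 // opprB.
have mut : maximizers [set` s] (c + t *: d) u.
  split; first by case: mu.
  move=> x xs; rewrite -!/(ev _ _) !evDl !evZl.
  have cx : ev c x <= ev c u by apply: mu.2.
  have [le|lt] := leP (ev d x) (ev d u); first by rewrite lerD // ler_wpM2l.
  have := hz1 x; rewrite mem_filter lt xs => /(_ isT).
  have xp : 0 < ev d x - ev d u by rewrite subr_gt0.
  by rewrite {1}/f ler_pdivrMr // -lerN2 -mulNr -/t mulrBr; lra.
split.
- move=> x mx; apply: (maximizers_ev mut); first by case: mx.
  by rewrite !evDl !evZl (dc _ mx) (maximizers_eq mx mu).
- apply: (maximizers_ev mut z1s).
  by rewrite !evDl !evZl; move: tz1; rewrite mulrBr; lra.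
- by move=> /dc e; move: uz1; rewrite e ltxx.
Qed.

End Faces.

(** Otherwise a nonzero column of the cokernel matrix would be a functional
vanishing on all the vectors. *)
Lemma span_full e (s : seq 'rV[R]_e) :
  (forall b : 'cV[R]_e, (forall x, x \in s -> ev b x = 0) -> b = 0) ->
  <<s>>%VS = fullv.
Proof.
move=> h.
pose B : 'M[R]_(size s, e) := \matrix_i s`_i.
have fB : row_full B.
  rewrite -cokermx_eq0; apply/eqP/matrixP => i j.
  have /colP/(_ i) : col j (cokermx B) = 0; last by rewrite !mxE.
  apply: h => _ /(nthP 0)[k ks <-].
  have : (B *m cokermx B) (Ordinal ks) j = 0 by rewrite mulmx_coker mxE.
  by rewrite /ev !mxE => E; rewrite -[RHS]E; apply: eq_bigr => l _; rewrite !mxE.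
apply/eqP; rewrite eqEsubv subvf; apply/subvP => v _.
rewrite -(mulmxKpV (submx_full v fB)) mulmx_sum_row rpred_sum // => i _.
by rewrite rpredZ // rowK memv_span // mem_nth.
Qed.

End FiniteSets.

(** * Faces of the upper envelope *)

Section Envelope.
Variables (R : realType) (e : nat).
Implicit Types (L : seq 'rV[R]_(e + 1)) (c : 'cV[R]_(e + 1)).
Implicit Types (z u v : 'rV[R]_(e + 1)) (b : 'cV[R]_e).

Definition height z : R := z 0 (rshift e ord0).
Definition slope c : R := c (rshift e ord0) 0.
Definition upward : set 'cV[R]_(e + 1) := [set c | 0 < slope c].

Lemma ev_split c z : ev c z = ev (usubmx c) (lsubmx z) + slope c * height z.
Proof.
rewrite /ev -{1}[z]hsubmxK -{1}[c]vsubmxK mul_row_col mxE; congr (_ + _).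
by rewrite mxE big_ord1 !mxE mulrC.
Qed.

(** Affine spanning of the projected points, stated through functionals: its
failure directly provides a direction in which to tilt. *)
Definition spanning (S : set 'rV[R]_(e + 1)) :=
  forall b, (forall z z', S z -> S z' -> ev b (lsubmx z) = ev b (lsubmx z')) ->
    b = 0.

(** The functional with base part b and last coefficient t; for t = 0 it is
horizontal and ignores the heights. *)
Definition tilted b (t : R) : 'cV[R]_(e + 1) := col_mx b t%:M.

Lemma slope_tilted b t : slope (tilted b t) = t.
Proof. by rewrite /slope col_mxEd mxE eqxx mulr1n. Qed.

Lemma ev_tilted b t z : ev (tilted b t) z = ev b (lsubmx z) + t * height z.
Proof. by rewrite ev_split col_mxKu slope_tilted. Qed.

Lemma tiltedE c : c = tilted (usubmx c) (slope c).
Proof.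
rewrite -{1}[c]vsubmxK; congr col_mx; apply/matrixP => i j.
by rewrite !mxE !ord1 eqxx mulr1n.
Qed.

Lemma slope_horizontal c t b : slope (c + t *: tilted b 0) = slope c.
Proof. by rewrite /slope 2!mxE -/(slope (tilted b 0)) slope_tilted mulr0 addr0. Qed.

(** Every upper face lies in an upper face whose projection spans.  As long as it
does not, some horizontal functional is constant on the face but not on L, and
tilting along it enlarges the face without changing the slope. *)
Lemma spanning_face L c z0 : z0 \in L -> upward c -> spanning [set` L] ->
  exists c0, [/\ upward c0, maximizers [set` L] c `<=` maximizers [set` L] c0
    & spanning (maximizers [set` L] c0)].
Proof.
move=> z0L + spL.
have [k] := ubnP (count (fun z => ~~ `[< maximizers [set` L] c z >]) L).
elim: k c => // k IH c; rewrite ltnS => hk cup.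
have [sp|] := pselect (spanning (maximizers [set` L] c)); first by exists c; split.
move=> /existsNP[b /not_implyP[bconst b0]].
have [u mu] := maximizers_exists c z0L.
have [z zL bz] : exists2 z, z \in L & ev b (lsubmx z) <> ev b (lsubmx u).
  apply: contrapT => h; apply: b0; apply: spL => z z' zL z'L.
  transitivity (ev b (lsubmx u)).
    by apply: contrapT => n; apply: h; exists z.
  by apply/esym; apply: contrapT => n; apply: h; exists z'.
have [d [d1 d2]] : exists d, ev d (lsubmx u) < ev d (lsubmx z) /\
    forall x, maximizers [set` L] c x -> ev d (lsubmx x) = ev d (lsubmx u).
  have := bz; move/eqP; rewrite neq_lt => /orP[lt|lt].
    exists (- b); split; first by rewrite !evNl ltrN2.
    by move=> x mx; rewrite !evNl (bconst _ _ mx mu).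
  by exists b; split=> // x mx; exact: bconst.
have [||t [z1 [sub m1 n1]]] := @tilt _ _ L c (tilted d 0) u z mu zL.
- by rewrite !ev_tilted !mul0r !addr0.
- by move=> x mx; rewrite !ev_tilted !mul0r !addr0 d2.
have [|| c0 [c0up sub0 sp0]] := IH (c + t *: tilted d 0).
- apply: leq_trans hk; apply: (@count_lt _ _ _ _ z1).
  + by move=> x; apply: contra => /asboolP mx; exact/asboolP/sub.
  + by case: m1.
  + exact/asboolP.
  + by rewrite negbK; apply/asboolP.
- by rewrite /upward /= slope_horizontal.
by exists c0; split=> //; apply: subset_trans sub0.
Qed.

(** On the face the functional is constant and has nonzero slope, so the heights
are determined by the base points: the projection is injective on the
directions of the face, and onto as the face spans. *)
Lemma spanning_has_dim L c z0 : z0 \in L -> upward c ->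
  spanning (maximizers [set` L] c) ->
  has_dim (convex_hull (maximizers [set` L] c)) e.
Proof.
move=> z0L cup sp; have [a ma] := maximizers_exists c z0L.
rewrite -face_seqE; have af : a \in face_seq L c.
  by have := ma; rewrite -face_seqE.
apply/(has_dim_hull _ af); set D := dirs _ _.
pose proj : 'Hom('rV[R]_(e + 1), 'rV[R]_e) := linfun (mulmxr (col_mx 1%:M 0)).
have projE z : proj z = lsubmx z.
  by rewrite lfunE /= -{1}[z]hsubmxK mul_row_col mulmx1 mulmx0 addr0.
pose cf : 'Hom('rV[R]_(e + 1), 'rV[R]_1) := linfun (mulmxr c).
have cfE z : cf z = (ev c z)%:M by rewrite lfunE /= [LHS]mx11_scalar.
have Dker z : z \in D -> ev c z = 0.
  move=> zD; have : z \in lker cf.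
    apply: (subvP (dirs_sub _)) zD => x xf; rewrite memv_ker cfE evB.
    rewrite (@maximizers_eq _ _ [set` L] c x a) ?subrr ?raddf0 //.
    by rewrite -face_seqE.
  by rewrite memv_ker cfE => /eqP/matrixP/(_ 0 0); rewrite !mxE eqxx mulr1n.
have inj : (D :&: lker proj)%VS = 0%VS.
  apply/eqP; rewrite -subv0; apply/subvP => z; rewrite memv_cap memv_ker memv0.
  case/andP => zD; rewrite projE => /eqP lz0; have := Dker z zD.
  rewrite ev_split lz0 ev0 add0r => /eqP; rewrite mulf_eq0.
  rewrite (gt_eqF cup) /= => /eqP hz.
  have rz0 : rsubmx z = 0 by apply/rowP => i; rewrite !mxE (ord1 i).
  by rewrite -[z]hsubmxK lz0 rz0 row_mx0.
rewrite -(limg_dim_eq inj) /D /dirs limg_span span_full ?dimvf /dim /= ?mul1n //.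
move=> b hb; apply: sp.
suff h z : maximizers [set` L] c z -> ev b (lsubmx z) = ev b (lsubmx a).
  by move=> z z' mz mz'; rewrite !h.
move=> mz; apply/eqP; rewrite -subr_eq0 -evB -linearB /= -projE; apply/eqP.
apply: hb; apply: map_f; apply: (map_f (fun x => x - a)).
by have := mz; rewrite -face_seqE.
Qed.

Lemma upward_open c c1 : upward c ->
  exists2 r, 0 < r & forall t, 0 < t -> t <= r -> upward (c + t *: c1).
Proof.
move=> cup; have [r r0 hr] := small_coef (- slope c1) cup.
exists r => // t t0 tr; rewrite /upward /= /slope !mxE -!/(slope _).
by have := hr t t0 tr; lra.
Qed.

(** Upward functionals form an open cone, so a perturbation selecting a subface
of an upper face can be taken upward. *)
Lemma upward_perturb L c c1 : upward c ->
  exists2 c', upward c' &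
    maximizers [set` L] c' = maximizers (maximizers [set` L] c) c1.
Proof.
move=> /(@upward_open _ c1)[r r0 hr]; have [r' r'0 hr'] := perturb L c c1.
have m0 : 0 < Num.min r r' by rewrite lt_min r0.
exists (c + Num.min r r' *: c1).
  by apply: hr => //; rewrite ge_min lexx.
by apply: hr' => //; rewrite ge_min lexx orbT.
Qed.

Lemma upper_facetP L F :
  is_upper_facet (convex_hull [set` L]) F <->
  exists c, [/\ upward c, F = convex_hull (maximizers [set` L] c) & has_dim F e].
Proof. by split=> -[c [c0 FE dF]]; exists c; rewrite maximizers_hull in FE *. Qed.

Lemma exposed_facet L c u : upward c -> maximizers [set` L] c u ->
  exposed upward [set` L] u -> exposed setT (maximizers [set` L] c) u.
Proof.
move=> cup mu [c' _ e']; exists c' => //.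
rewrite (@maximizers_subset _ _ _ [set` L] c' u) ?e' //.
  by apply/seteqP; split=> [x []|x ->].
by move=> x [].
Qed.

(** Left to right, a vertex of a facet is selected by a perturbation of the
functional of the facet; right to left, the facet is the one that tilting
produces. *)
Lemma envelope_vertices L v : spanning [set` L] ->
  (exists2 F, is_upper_facet (convex_hull [set` L]) F & vertices F v) <->
  exposed upward [set` L] v.
Proof.
move=> spL; split.
  case=> F /upper_facetP[c [cup -> _]] /vertices_hull[c1 _ e1].
  by have [c' c'up e'] := upward_perturb L c1 cup; exists c' => //; rewrite e'.
move=> xv; have [c cup eV] := xv.
have vL : v \in L by exact: exposed_mem xv.
have [c0 [c0up sub sp]] := spanning_face vL cup spL.
exists (convex_hull (maximizers [set` L] c0)).
  by apply/upper_facetP; exists c0; split=> //; exact: spanning_has_dim vL _ _.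
apply/vertices_hull; apply: exposed_facet => //.
by apply: sub; rewrite eV.
Qed.

Lemma envelope_edges L u v : spanning [set` L] ->
  (exists2 F, is_upper_facet (convex_hull [set` L]) F & are_joined F u v) <->
  exposed_edge upward [set` L] u v.
Proof.
move=> spL; split.
  case=> F fF juv; have [vu vv uv _] := juv.
  split=> //.
  - by apply/envelope_vertices => //; exists F.
  - by apply/envelope_vertices => //; exists F.
  have /upper_facetP[c [cup eF _]] := fF; move: juv; rewrite eF.
  move=> /joined_hull[_ _ _ [c1 [_ mu mv sub]]].
  by have [c' c'up e'] := upward_perturb L c1 cup; exists c'; rewrite e'.
case=> vu vv uv [c [cup mu mv sub]].
have uL : u \in L by exact: exposed_mem vu.
have [c0 [c0up sub0 sp]] := spanning_face uL cup spL.
exists (convex_hull (maximizers [set` L] c0)).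
  by apply/upper_facetP; exists c0; split=> //; exact: spanning_has_dim uL _ _.
apply/joined_hull; split=> //.
- by apply: exposed_facet => //; exact: sub0.
- by apply: exposed_facet => //; exact: sub0.
exists c.
have -> : maximizers (maximizers [set` L] c0) c =
    maximizers [set` L] c `&` maximizers [set` L] c0.
  by apply: (maximizers_subset _ mu) => [x []|]; [|exact: sub0].
split=> //; [split=> //; exact: sub0|split=> //; exact: sub0|].
by move=> x [mx _]; exact: sub.
Qed.

End Envelope.

Arguments upward {R e}.

(** * The warped product *)

Section Warped.
Variables (R : realType) (n e : nat).
Variables (A : seq 'rV[R]_n) (L : seq 'rV[R]_(e + 1)) (x0 : 'rV[R]_n) (K : R).
Implicit Types (p q : 'rV[R]_n) (z : 'rV[R]_(e + 1)).
Implicit Types (a : 'cV[R]_n) (b : 'cV[R]_e) (c : 'cV[R]_(n + e)).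

(** The factor height z + K scales the copy of P placed over the base point of
z; this is what makes a functional on the first block act as a slope on the
second. *)
Definition warp p z : 'rV[R]_(n + e) :=
  row_mx ((height z + K) *: (p - x0)) (lsubmx z).

Definition warped := [seq warp p z | p <- A, z <- L].

Hypothesis height_pos : forall z, z \in L -> 0 < height z + K.
Hypothesis lsub_inj : {in L &, injective (@lsubmx R 1 e 1)}.

Lemma ev_warped c p z : ev c (warp p z) =
  (height z + K) * ev (usubmx c) (p - x0) + ev (dsubmx c) (lsubmx z).
Proof. by rewrite /ev -{1}[c]vsubmxK mul_row_col mxE -scalemxAl [in LHS]mxE. Qed.

Lemma warp_inj p z p' z' : z \in L -> z' \in L ->
  warp p z = warp p' z' -> p = p' /\ z = z'.
Proof.
move=> zL z'L /eq_row_mx[e1 /(lsub_inj zL z'L) e2]; split=> //; subst z'.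
by move: e1 => /(scalerI (lt0r_neq0 (height_pos zL)))/addIr.
Qed.

Lemma mem_warped p z : p \in A -> z \in L -> warp p z \in warped.
Proof. by move=> pA zL; apply/allpairsP; exists (p, z). Qed.

(** Positivity of the factors makes the value monotone in the value at p, so the
maximum is attained first over A and then over L, for the slope equal to the
maximum over A. *)
Lemma maximizers_warped c p1 x : maximizers [set` A] (usubmx c) p1 ->
  maximizers [set` warped] c x <->
  exists p z, [/\ x = warp p z, maximizers [set` A] (usubmx c) p
    & maximizers [set` L] (tilted (dsubmx c) (ev (usubmx c) (p1 - x0))) z].
Proof.
set a := usubmx c; set b := dsubmx c; set M := ev a _ => mp1.
have val_le p z : p \in A -> z \in L ->
    ev c (warp p z) <= ev (tilted b M) z + K * M.
  move=> pA zL; rewrite ev_warped ev_tilted -/a -/b.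
  have pM : ev a (p - x0) <= M by rewrite /M !evB lerD2r; exact: mp1.2.
  have := ler_wpM2l (ltW (height_pos zL)) pM; lra.
have val_eq p z : maximizers [set` A] a p ->
    ev c (warp p z) = ev (tilted b M) z + K * M.
  move=> mp; rewrite ev_warped ev_tilted -/a -/b.
  have -> : ev a (p - x0) = M by rewrite /M !evB (maximizers_eq mp mp1).
  by lra.
have p1A : p1 \in A by case: mp1.
split.
  case=> /allpairsP[[p z] /= [pA zL ->]] mx.
  have [z1 mz1] := maximizers_exists (tilted b M) zL.
  have z1L : z1 \in L by case: mz1.
  have := mx _ (mem_warped p1A z1L); rewrite -!/(ev _ _) (val_eq _ _ mp1) => le1.
  have le2 : ev (tilted b M) z <= ev (tilted b M) z1 by exact: mz1.2.
  have le3 := val_le p z pA zL.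
  exists p, z; split=> //.
    apply: (maximizers_ev mp1 pA); apply: (addIr (- ev a x0)).
    rewrite -!evB -/M; apply: (mulfI (lt0r_neq0 (height_pos zL))).
    by move: le1 le2 le3; rewrite ev_warped !ev_tilted -/a -/b; lra.
  by apply: (maximizers_ev mz1 zL); lra.
case=> p [z [-> mp mz]]; split.
  by apply: mem_warped; [case: mp|case: mz].
move=> _ /allpairsP[[q y] /= [qA yL ->]]; rewrite -!/(ev _ _) (val_eq _ _ mp).
by apply: le_trans (val_le _ _ qA yL) _; rewrite lerD2r; exact: mz.2.
Qed.

Lemma warp_affine p z z' t :
  warp p (z + t *: (z' - z)) =
  warp p z + t *: (warp p z' - warp p z).
Proof.
rewrite /warp opp_row_mx add_row_mx scale_row_mx add_row_mx.
congr row_mx; last by rewrite linearD linearZ linearB.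
rewrite -scalerBl scalerA -scalerDl; congr (_ *: _).
by rewrite /height !mxE; ring.
Qed.

Lemma warp_on_line p z p' z' q y :
  on_line (warp p z) (warp p' z') (warp q y) ->
  exists t, lsubmx y = lsubmx z + t *: (lsubmx z' - lsubmx z) /\
    (height y + K) *: (q - x0) = (height z + K) *: (p - x0) +
       t *: ((height z' + K) *: (p' - x0) - (height z + K) *: (p - x0)).
Proof.
move=> /on_lineP[t]; rewrite /warp opp_row_mx add_row_mx scale_row_mx.
by rewrite add_row_mx => /eq_row_mx[e1 e2]; exists t.
Qed.

(** Two points of X over the same z have the same base point, whereas the line
through points over z and z' takes each base point only once. *)
Lemma warp_line_fst p z p' z' q : z \in L -> z' \in L -> z <> z' ->
  on_line (warp p z) (warp p' z') (warp q z) -> q = p.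
Proof.
move=> zL z'L zz' /warp_on_line[t [/eqP]].
rewrite -subr_eq0 opprD addrA subrr sub0r oppr_eq0 scaler_eq0 subr_eq0.
case/orP => [/eqP -> |/eqP/(lsub_inj z'L zL) e0]; last by case: zz'.
by rewrite scale0r addr0 => /(scalerI (lt0r_neq0 (height_pos zL)))/addIr.
Qed.

Lemma warp_line_same z p p' q : z \in L ->
  on_line (warp p z) (warp p' z) (warp q z) <->
  on_line p p' q.
Proof.
move=> zL; have h0 := lt0r_neq0 (height_pos zL); split.
  case/warp_on_line => t [_]; rewrite -scalerBr scalerA mulrC -scalerA.
  rewrite -scalerDr => /(scalerI h0) E; apply/on_lineP; exists t.
  by apply: (addIr (- x0)); rewrite E opprB addrA subrK addrAC.
case/on_lineP => t ->; apply/on_lineP; exists t.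
rewrite /warp opp_row_mx add_row_mx scale_row_mx add_row_mx.
rewrite subrr scaler0 addr0; congr row_mx.
rewrite -scalerBr scalerA mulrC -scalerA -scalerDr; congr (_ *: _).
by rewrite opprB addrA subrK addrAC.
Qed.

(** The next two hypotheses say that x0 lies in the relative interior of the
hull of A; the centroid of A has both properties. *)
Hypothesis centered_ge0 : forall a p, maximizers [set` A] a p -> 0 <= ev a (p - x0).
Hypothesis centered_eq0 : forall a p q, maximizers [set` A] a p ->
  ev a (p - x0) = 0 -> q \in A -> maximizers [set` A] a q.
Hypothesis A_nontrivial : forall p, exists2 q, q \in A & q <> p.

(** Rescaling an upward functional gives it any prescribed positive slope without
changing its face. *)
Lemma tilted_scale (c : 'cV[R]_(e + 1)) b t M : c = tilted b t -> 0 < t -> 0 < M ->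
  maximizers [set` L] (tilted ((M / t) *: b) M) = maximizers [set` L] c.
Proof.
move=> -> t0 M0; rewrite -[RHS](@maximizersZ _ _ _ _ (M / t)) ?divr_gt0 //.
congr maximizers; rewrite /tilted scale_col_mx; congr col_mx.
by rewrite scale_scalar_mx divfK ?lt0r_neq0.
Qed.

Lemma warped_face_single a p (c : 'cV[R]_(e + 1)) :
  maximizers [set` A] a = [set p] -> upward c ->
  exists c', forall x, maximizers [set` warped] c' x <->
    exists2 z, maximizers [set` L] c z & x = warp p z.
Proof.
move=> ap cup; have mp : maximizers [set` A] a p by rewrite ap.
have M0 : 0 < ev a (p - x0).
  rewrite lt_def centered_ge0 // andbT; apply/eqP => e0.
  have [q qA qp] := A_nontrivial p.
  by have := centered_eq0 mp e0 qA; rewrite ap.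
exists (col_mx a ((ev a (p - x0) / slope c) *: usubmx c)) => x.
rewrite (@maximizers_warped _ p) ?col_mxKu // col_mxKd.
rewrite (tilted_scale (tiltedE c)) // ap; split.
  by case=> _ [z [-> -> mz]]; exists z.
by case=> z mz ->; exists p, z.
Qed.

(** A functional that singles out a point of X cannot be constant on A, since A
has a second point; so its maximum over A is a positive slope. *)
Lemma warped_exposed x : exposed setT [set` warped] x <->
  exists p z, [/\ x = warp p z, exposed setT [set` A] p
    & exposed upward [set` L] z].
Proof.
split.
  case=> c _ ex; have : maximizers [set` warped] c x by rewrite ex.
  have xw : x \in warped by have [] : maximizers [set` warped] c x by rewrite ex.
  move: (xw) => /allpairsP[[p0 z0] /= [p0A z0L _]].
  have [p1 mp1] := maximizers_exists (usubmx c) p0A.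
  have faceP := maximizers_warped _ mp1.
  case/faceP => p [z [xE mp mz]]; exists p, z.
  have uniq q y : maximizers [set` A] (usubmx c) q ->
      maximizers [set` L] (tilted (dsubmx c) (ev (usubmx c) (p1 - x0))) y ->
      q = p /\ y = z.
    move=> mq my; have : maximizers [set` warped] c (warp q y).
      by apply/faceP; exists q, y.
    rewrite ex xE => /warp_inj; apply; [by case: my|by case: mz].
  split=> //.
    exists (usubmx c) => //; apply/seteqP; split=> [q mq|_ -> //].
    by have [] := uniq q z mq mz.
  exists (tilted (dsubmx c) (ev (usubmx c) (p1 - x0))).
    rewrite /upward /= slope_tilted lt_def centered_ge0 // andbT.
    apply/eqP => e0; have [q qA qp] := A_nontrivial p.
    by have [] := uniq q z (centered_eq0 mp1 e0 qA) mz.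
  apply/seteqP; split=> [y my|_ -> //].
  by have [] := uniq p y mp my.
case=> p [z [-> [a _ ap] [c cup cz]]].
have [c' hc'] := warped_face_single ap cup; exists c' => //.
apply/seteqP; split=> [w /hc'|_ ->]; first by rewrite cz => -[_ -> ->].
by apply/hc'; exists z => //; rewrite cz.
Qed.

(** If the hull of A is a segment, the edge over z is selected only by
functionals whose first block is constant on A; these see L at slope zero, so
a horizontal functional has to single out z. *)
Hypothesis segment_case : forall p q z,
  [set` A] `<=` on_line p q -> exposed upward [set` L] z ->
  exists b, maximizers [set` L] (tilted b 0) = [set z].

(** If z and z' differ, the face can contain no point over z besides the given
one, so the functional is not constant on A and its slope is positive; equal
values at positive slope then determine the heights on the line from the base
points.  If z = z', the face over z is a copy of a face of P. *)
Lemma warped_edge p z p' z' :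
  exposed setT [set` A] p -> exposed setT [set` A] p' ->
  exposed upward [set` L] z -> exposed upward [set` L] z' ->
  exposed_edge setT [set` warped] (warp p z) (warp p' z') <->
  (p = p' /\ exposed_edge upward [set` L] z z') \/
  (z = z' /\ exposed_edge setT [set` A] p p').
Proof.
move=> xp xp' xz xz'.
have pA : p \in A := exposed_mem xp.
have p'A : p' \in A := exposed_mem xp'.
have zL : z \in L := exposed_mem xz.
have z'L : z' \in L := exposed_mem xz'.
have xw q y : exposed setT [set` A] q -> exposed upward [set` L] y ->
  exposed setT [set` warped] (warp q y).
  by move=> *; apply/warped_exposed; exists q, y.
split.
  case=> _ _ ne [c [_ mx mx' sub]].
  have [p1 mp1] := maximizers_exists (usubmx c) pA.
  have faceP := maximizers_warped _ mp1.
  set a := usubmx c in mp1 faceP; set b := dsubmx c in faceP.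
  set M := ev a (p1 - x0) in faceP.
  have point q y : y \in L -> maximizers [set` warped] c (warp q y) ->
    maximizers [set` A] a q /\ maximizers [set` L] (tilted b M) y.
    move=> yL /faceP[q' [y' [E mq my]]].
    by have [|-> ->] := warp_inj yL _ E; first by case: my.
  have [mp mz] := point _ _ zL mx; have [mp' mz'] := point _ _ z'L mx'.
  have onl q y : maximizers [set` A] a q ->
      maximizers [set` L] (tilted b M) y ->
      on_line (warp p z) (warp p' z') (warp q y).
    by move=> mq my; apply: sub; apply/faceP; exists q, y.
  have [zz'|/eqP zz'] := eqVneq z z'.
    right; split=> //; subst z'; split=> //; first by move=> pp'; subst p'.
    exists a; split=> // q mq; apply/(warp_line_same _ _ _ zL); exact: onl.
  have fst q : maximizers [set` A] a q -> q = p.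
    by move=> mq; apply: (warp_line_fst zL z'L zz'); exact: onl.
  left; split; first by rewrite (fst _ mp').
  have M0 : 0 < M.
    rewrite lt_def centered_ge0 // andbT; apply/eqP => e0.
    have [q qA] := A_nontrivial p; apply; apply: fst.
    exact: centered_eq0 mp1 e0 qA.
  split=> //; exists (tilted b M); split=> //.
    by rewrite /upward /= slope_tilted.
  move=> y my; have [t [ly _]] := warp_on_line (onl _ _ mp my).
  apply/on_lineP; exists t; set w := z + _.
  have lw : lsubmx w = lsubmx y by rewrite ly /w linearD linearZ linearB.
  have hw : height w = height y.
    have : ev (tilted b M) w = ev (tilted b M) y.
      rewrite (maximizers_eq my mz) /w evD evZ evB (maximizers_eq mz' mz).
      by rewrite subrr mulr0 addr0.
    by rewrite !ev_tilted lw => /addrI/(mulfI (lt0r_neq0 M0)).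
  rewrite -[y]hsubmxK -[w]hsubmxK lw; congr row_mx.
  by apply/rowP => i; rewrite (ord1 i) mxE [RHS]mxE; exact: esym hw.
case=> [[pp' [_ _ zz' [c [cup mz mz' sub]]]]|[zz' [_ _ pp' [a [_ mp mp' sub]]]]].
  subst p'; have [a _ ap] := xp.
  split; [exact: xw..| |].
    by move=> /(warp_inj zL z'L)[].
  have [c' hc'] := warped_face_single ap cup; exists c'; split=> //.
  - by apply/hc'; exists z.
  - by apply/hc'; exists z'.
  move=> _ /hc'[y my ->]; have /on_lineP[t ->] := sub _ my.
  by apply/on_lineP; exists t; exact: warp_affine.
subst z'; split; [exact: xw..| |].
  by move=> /(warp_inj zL z'L)[].
suff [b bz] : exists b, maximizers [set` L] (tilted b (ev a (p - x0))) = [set z].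
  exists (col_mx a b); have faceP x := maximizers_warped (c := col_mx a b) (p1 := p) x.
  rewrite col_mxKu col_mxKd bz in faceP; split=> //.
  - by apply/faceP => //; exists p, z.
  - by apply/faceP => //; exists p', z.
  by move=> _ /faceP[//|q [_ [-> mq ->]]]; apply/(warp_line_same _ _ _ zL); exact: sub.
(* a maximum of 0 means that a is constant, so all of A lies on the edge *)
have [M0|M0] := eqVneq (ev a (p - x0)) 0.
  rewrite M0; apply: (segment_case (p := p) (q := p')) => // q qA.
  by apply: sub; exact: centered_eq0 mp M0 qA.
have {}M0 : 0 < ev a (p - x0) by rewrite lt_def M0 centered_ge0.
have [c cup cz] := xz.
by exists ((ev a (p - x0) / slope c) *: usubmx c); rewrite (tilted_scale (tiltedE c)).
Qed.

End Warped.

(** * Dimension of the warped product *)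

Section WarpedDimension.
Variables (R : realType) (n e : nat).

(** The directions of X form the direct sum of the directions of P and of the
whole base space.  Moving p over a fixed z0 gives the first summand; moving z
with p0 fixed gives the second one up to a vector of the first. *)
Lemma warped_has_dim (A : seq 'rV[R]_n) (L : seq 'rV[R]_(e + 1)) x0 K p0 z0 d :
  p0 \in A -> z0 \in L -> x0 - p0 \in dirs p0 A -> 0 < height z0 + K ->
  spanning [set` L] -> \dim (dirs p0 A) = d ->
  has_dim (convex_hull [set` warped A L x0 K]) (d + e).
Proof.
move=> p0A z0L x0U h0 spL dU; set U := dirs p0 A in x0U dU.
pose i1 : 'Hom('rV[R]_n, 'rV[R]_(n + e)) := linfun (mulmxr (row_mx 1%:M 0)).
pose i2 : 'Hom('rV[R]_e, 'rV[R]_(n + e)) := linfun (mulmxr (row_mx 0 1%:M)).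
have i1E u : i1 u = row_mx u 0 by rewrite lfunE /= mul_mx_row mulmx1 mulmx0.
have i2E w : i2 w = row_mx 0 w by rewrite lfunE /= mul_mx_row mulmx1 mulmx0.
apply/(has_dim_hull _ (mem_warped x0 K p0A z0L)).
set D := dirs _ _.
have inU p : p \in A -> p - x0 \in U.
  move=> pA; have := rpredB (mem_dirs p0 pA) x0U.
  by rewrite opprB addrA subrK.
have hU k1 k2 p q : p \in A -> q \in A -> k1 *: (p - x0) - k2 *: (q - x0) \in U.
  by move=> pA qA; rewrite rpredB // rpredZ // inU.
have U_D : (i1 @: U <= D)%VS.
  rewrite limg_span; apply/span_subvP => _ /mapP[_ /mapP[p pA ->] ->].
  have : (height z0 + K)^-1 *: (warp x0 K p z0 - warp x0 K p0 z0) \in D.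
    by rewrite rpredZ // mem_dirs // mem_warped.
  rewrite i1E /warp opp_row_mx add_row_mx subrr -scalerBr scale_row_mx.
  by rewrite scalerA mulVf ?lt0r_neq0 // scale1r scaler0 opprB addrA subrK.
have W_D : (i2 @: fullv <= D)%VS.
  have <- : <<[seq lsubmx z - lsubmx z0 | z <- L]>>%VS = fullv.
    apply: span_full => b hb; apply: spL => z z' zL z'L.
    suff h y : y \in L -> ev b (lsubmx y) = ev b (lsubmx z0) by rewrite !h.
    move=> yL; apply/eqP; rewrite -subr_eq0 -evB; apply/eqP/hb.
    exact: (map_f (fun y => lsubmx y - lsubmx z0)).
  rewrite limg_span; apply/span_subvP => _ /mapP[_ /mapP[z zL ->] ->].
  have DD : warp x0 K p0 z - warp x0 K p0 z0 \in D.
    by rewrite mem_dirs // mem_warped.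
  have := rpredB DD (subvP U_D _
    (memv_img i1 (hU (height z + K) (height z0 + K) _ _ p0A p0A))).
  rewrite i1E i2E /warp opp_row_mx add_row_mx opp_row_mx add_row_mx.
  by rewrite subrr oppr0 addr0.
have -> : D = (i1 @: U + i2 @: fullv)%VS.
  apply/eqP; rewrite eqEsubv subv_add U_D W_D !andbT.
  apply: dirs_sub => _ /allpairsP[[p z] /= [pA zL ->]].
  rewrite /warp opp_row_mx add_row_mx -[X in row_mx X]addr0.
  rewrite -[X in row_mx _ X]add0r -add_row_mx -i1E -i2E.
  by rewrite memv_add ?memv_img ?memvf ?hU.
rewrite dimv_disjoint_sum; last first.
  apply/eqP; rewrite -subv0; apply/subvP => x; rewrite memv_cap memv0.
  case/andP => /memv_imgP[u _ ->] /memv_imgP[w _]; rewrite i1E i2E.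
  by case/eq_row_mx => -> _; rewrite row_mx0.
rewrite !limg_dim_eq.
- by rewrite dU dimvf /dim /= mul1n.
- apply/eqP; rewrite -subv0; apply/subvP => w; rewrite memv_cap memv_ker memv0.
  by rewrite i2E => /andP[_ /eqP E]; have := congr1 rsubmx E; rewrite row_mxKr linear0 => ->.
- apply/eqP; rewrite -subv0; apply/subvP => w; rewrite memv_cap memv_ker memv0.
  by rewrite i1E => /andP[_ /eqP E]; have := congr1 lsubmx E; rewrite row_mxKl linear0 => ->.
Qed.

End WarpedDimension.

(** * The centroid *)

Section Centroid.
Variables (R : realType) (n : nat).
Variable A : seq 'rV[R]_n.
Implicit Types (a : 'cV[R]_n) (p q : 'rV[R]_n).

Definition centroid : 'rV[R]_n := (size A)%:R^-1 *: \sum_(p <- A) p.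

Lemma sum_sub_centroid p : p \in A ->
  \sum_(q <- A) (p - q) = (size A)%:R *: (p - centroid).
Proof.
move=> pA; have s0 : (size A)%:R != 0 :> R.
  by rewrite pnatr_eq0 size_eq0; apply: contraTneq pA => ->.
rewrite sumrB big_const_seq count_predT iter_addr_0 scalerBr scalerA mulfV //.
by rewrite scale1r scaler_nat.
Qed.

(** The value at a maximizer minus the value at the centroid is the average of
the nonnegative gaps to all the points; in particular it vanishes only if all
the gaps do. *)
Lemma centroid_ge0 a p : maximizers [set` A] a p -> 0 <= ev a (p - centroid).
Proof.
move=> mp; have pA : p \in A by case: mp.
have s0 : 0 < (size A)%:R :> R by rewrite ltr0n; case: A pA.
rewrite -(pmulr_rge0 _ s0) -evZ -sum_sub_centroid // ev_sum.
by rewrite big_seq sumr_ge0 // => q qA; rewrite evB subr_ge0; exact: mp.2.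
Qed.

Lemma centroid_eq0 a p q : maximizers [set` A] a p ->
  ev a (p - centroid) = 0 -> q \in A -> maximizers [set` A] a q.
Proof.
move=> mp e0 qA; have pA : p \in A by case: mp.
apply: (maximizers_ev mp qA).
have : \sum_(q <- A) ev a (p - q) == 0.
  by rewrite -ev_sum sum_sub_centroid // evZ e0 mulr0.
rewrite big_seq psumr_eq0 => [/allP/(_ q qA)|r rA].
  by rewrite qA /= evB subr_eq0 => /eqP.
by rewrite evB subr_ge0; exact: mp.2.
Qed.

Lemma centroid_dirs p : p \in A -> centroid - p \in dirs p A.
Proof.
move=> pA; rewrite -opprB rpredN.
have s0 : (size A)%:R != 0 :> R.
  by rewrite pnatr_eq0 size_eq0; apply: contraTneq pA => ->.
rewrite -[p - _]scale1r -(mulVf s0) -scalerA -sum_sub_centroid // rpredZ //.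
by rewrite big_seq rpred_sum // => q qA; rewrite -opprB rpredN mem_dirs.
Qed.

End Centroid.

(** * The product graph *)

Lemma polytope_generators (R : realType) n k (P : set 'rV[R]_n) :
  is_polytope k P -> exists s a, [/\ P = convex_hull [set` s], a \in s
    & \dim (dirs a s) = k].
Proof.
move=> [[S /finite_seqP[s ->] ->] dP].
have [a sa] : exists a, a \in s.
  case: s dP => [|a s] dP; last by exists a; exact: mem_head.
  have /has_dimP[v [U [_ E]]] := dP; exfalso.
  have [m [p [c [Ap c1 _]]]] : affine_hull (convex_hull [set` [::]]) v.
    by rewrite E; exact: flat_base.
  case: m p c Ap c1 => [|m] p c Ap c1.
    by move/eqP: c1; rewrite big_ord0 eq_sym oner_eq0.
  have : convex_hull [set` [::]] `<=` (set0 : set 'rV[R]_n).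
    by apply: hull_sub => //; apply/convex_setP.
  by move=> /(_ _ (Ap ord0)).
by exists s, a; split=> //; apply/(has_dim_hull _ sa).
Qed.

(** A functional on a finite set attains its maximum and its minimum at vertices,
so one that is constant on vertices is constant everywhere. *)
Lemma const_on_vertices_eq0 (R : realType) e (s : seq 'rV[R]_e) a (b : 'cV[R]_e) :
  a \in s -> \dim (dirs a s) = e ->
  (forall v v', vertices (convex_hull [set` s]) v ->
    vertices (convex_hull [set` s]) v' -> ev b v = ev b v') -> b = 0.
Proof.
move=> sa ds bV.
have bc x : x \in s -> ev b (x - a) = 0.
  move=> xs; rewrite evB; apply/eqP; rewrite subr_eq0; apply/eqP.
  have [v vv [_ mv]] := exposed_maximizer b sa.
  (* a maximum of - b is a minimum of b *)
  have [v' vv' [_ mv']] := exposed_maximizer (- b) sa.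
  have vE : ev b v = ev b v' by apply: bV; exact/vertices_hull.
  have lo y : y \in s -> ev b v <= ev b y.
    by move=> ys; have := mv' y ys; rewrite -!/(ev _ _) !evNl lerN2 vE.
  apply/le_anti; rewrite (le_trans (mv x xs) (lo a sa)).
  by rewrite (le_trans (mv a sa) (lo x xs)).
pose bf : 'Hom('rV[R]_e, 'rV[R]_1) := linfun (mulmxr b).
have bfE x : bf x = (ev b x)%:M by rewrite lfunE /= [LHS]mx11_scalar.
have full : dirs a s = fullv.
  by apply/eqP; rewrite eqEdim subvf ds dimvf /dim /= mul1n.
have ker y : ev b y = 0.
  have : y \in lker bf.
    apply: (subvP (dirs_sub _)) (_ : y \in dirs a s); last by rewrite full memvf.
    by move=> x xs; rewrite memv_ker bfE bc // raddf0.
  by rewrite memv_ker bfE => /eqP/matrixP/(_ 0 0); rewrite !mxE eqxx mulr1n.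
apply/colP => j; have := ker (delta_mx 0 j); by rewrite /ev -rowE !mxE.
Qed.

(** Both parts of the theorem in one: internal points come in only through W,
and the alternative d > 1 or W = vertices Q serves the case where P is a
segment. *)
Lemma product_polytopal (R : realType) (d n e : nat)
    (P : set 'rV[R]_n) (Q : set 'rV[R]_e) (G H : sgraph)
    (W : set 'rV[R]_e) (omega : 'rV[R]_e -> R) :
  (0 < d)%N -> is_polytope d P -> is_polytope_graph G P -> is_polytope e Q ->
  finite_set W -> vertices Q `<=` W -> (1 < d)%N \/ W = vertices Q ->
  is_regular_subdivision_graph H W omega ->
  polytopal R (d + e) (cart_prod G H).
Proof.
move=> d0 polP [f [f_inj f_rng f_adj]] polQ finW VW dW [g [g_inj g_rng g_adj]].
have [A [p0 [PE p0A dA]]] := polytope_generators polP.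
have [B [b0 [QE b0B dB]]] := polytope_generators polQ.
have /finite_seqP[w WE] := finW.
pose L := [seq lift_point omega q | q <- w].
have LE : lift_point omega @` W = [set` L].
  by rewrite WE; apply/seteqP; split=> [_ [q qw <-]|_ /mapP[q qw ->]];
    [exact: map_f|exists q].
have lsub_lift q : lsubmx (lift_point omega q) = q by rewrite row_mxKl.
have Lw z : z \in L -> W (lsubmx z) /\ lift_point omega (lsubmx z) = z.
  by move=> /mapP[q qw ->]; rewrite lsub_lift WE.
have wL q : W q -> lift_point omega q \in L by rewrite WE => qw; exact: map_f.
have spL : spanning [set` L].
  move=> b hb; apply: (const_on_vertices_eq0 b0B dB) => v v'; rewrite -QE => /VW vW /VW v'W.
  by have := hb _ _ (wL _ vW) (wL _ v'W); rewrite !lsub_lift.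
have [z0 z0L] : exists z0, z0 \in L.
  have [v vv _] := exposed_maximizer 0 b0B.
  by exists (lift_point omega v); apply/wL/VW; rewrite QE; exact/vertices_hull.
have Linj : {in L &, injective (@lsubmx R 1 e 1)}.
  by move=> z z' /Lw[_ {2}<-] /Lw[_ {2}<-] ->.
have [K Kpos] : exists K, forall z, z \in L -> 0 < height z + K.
  have [z1 _ hz1] := seq_argmax (fun z => - height z) z0L.
  by exists (1 - height z1) => z /hz1; lra.
have A_line p q : [set` A] `<=` on_line p q -> (d <= 1)%N.
  move=> Al; rewrite -dA; apply: leq_trans (_ : \dim <[q - p]>%VS <= 1)%N.
    apply/dimvS/dirs_sub => x xA; have := rpredB (Al _ xA) (Al _ p0A).
    by rewrite opprB addrA subrK.
  by rewrite dim_vline; case: (_ != 0).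
have A_nontrivial p : exists2 q, q \in A & q <> p.
  apply: contrapT => h; move: d0; rewrite lt0n -dA dimv_eq0 -subv0; apply/negP/negPn.
  have Ap q : q \in A -> q = p by move=> qA; apply: contrapT => ne; apply: h; exists q.
  apply: dirs_sub => x xA; by rewrite (Ap _ xA) (Ap _ p0A) subrr mem0v.
pose x0 := centroid A; pose X := warped A L x0 K.
have segment p q z : [set` A] `<=` on_line p q -> exposed upward [set` L] z ->
    exists b, maximizers [set` L] (tilted b 0) = [set z].
  move=> /A_line d1 /exposed_mem zL.
  case: dW => [|WV]; first by rewrite ltnNge d1.
  have [zW zE] := Lw z zL.
  have : vertices Q (lsubmx z) by rewrite -WV.
  case=> b bE; exists b.
  have mz : maximizers Q b (lsubmx z) by rewrite -bE.
  have WQ y : W y -> Q y.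
    by rewrite WV => -[b' b'E]; have [] : maximizers Q b' y by rewrite -b'E.
  have mz' : maximizers [set` L] (tilted b 0) z.
    split=> // y yL; rewrite -!/(ev _ _) !ev_tilted !mul0r !addr0.
    by apply: mz.2; apply: WQ; exact: (Lw y yL).1.
  apply/seteqP; split=> [y my|_ -> //].
  have yL : y \in L by case: my.
  apply: Linj => //; have := maximizers_eq my mz'.
  rewrite !ev_tilted !mul0r !addr0 => E.
  have : maximizers Q b (lsubmx y).
    by apply: (maximizers_ev mz) => //; apply: WQ; exact: (Lw y yL).1.
  by rewrite -bE.
have fV x : exposed setT [set` A] (f x).
  by apply/vertices_hull; rewrite -PE -f_rng; exists x.
have gV y : exposed upward [set` L] (g y).
  apply/envelope_vertices => //; rewrite -LE.
  suff: range g (g y) by rewrite g_rng.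
  by exists y.
have gL y : g y \in L := exposed_mem (gV y).
have exposedE := warped_exposed Kpos Linj (@centroid_ge0 _ _ A)
  (@centroid_eq0 _ _ A) A_nontrivial.
have edgeE := warped_edge Kpos Linj (@centroid_ge0 _ _ A)
  (@centroid_eq0 _ _ A) A_nontrivial segment.
pose F (x : cart_prod G H) : 'rV[R]_(n + e) := warp x0 K (f x.1) (g x.2).
exists (n + e)%N, (convex_hull [set` X]); split.
  split; first by exists [set` X] => //; exact: finite_seq.
  apply: (warped_has_dim p0A z0L) => //; [exact: centroid_dirs|exact: Kpos].
exists F; split.
- move=> [x y] [x' y'] /(warp_inj Kpos Linj (gL _) (gL _))[].
  by rewrite /= => /f_inj -> /g_inj ->.
- apply/seteqP; split=> [_ [[x y] _ <-]|v].
    apply/vertices_hull/exposedE.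
    by exists (f x), (g y).
  move=> /vertices_hull/exposedE.
  case=> p [z [-> /vertices_hull vp ez]].
  have [x _ xE] : range f p by rewrite f_rng PE.
  have [y _ yE] : range g z by rewrite g_rng /upper_envelope LE; exact/envelope_vertices.
  by exists (x, y) => //; rewrite /F /= xE yE.
- move=> [x y] [x' y'].
  rewrite joined_hull edgeE //.
  rewrite /= /cart_adj /= -joined_hull -PE -f_adj -(envelope_edges _ _ spL) -LE -g_adj.
  split.
    by case/orP => /andP[/eqP -> h]; [left|right].
  by case=> -[E h]; apply/orP; [left|right]; rewrite h andbT; apply/eqP; [exact: f_inj|exact: g_inj].
Qed.

Theorem proposition2p8 (R : realType) (d n e : nat)
    (P : set 'rV[R]_n) (Q : set 'rV[R]_e) (G H : sgraph) :
  (0 < d)%N ->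
  is_polytope d P -> is_polytope_graph G P -> is_polytope e Q ->
  (forall omega : 'rV[R]_e -> R,
     is_regular_subdivision_graph H (vertices Q) omega ->
     polytopal R (d + e) (cart_prod G H)) /\
  ((1 < d)%N ->
   forall (I : set 'rV[R]_e) (omega : 'rV[R]_e -> R),
     finite_set I -> I `<=` interior Q ->
     is_regular_subdivision_graph H (vertices Q `|` I) omega ->
     polytopal R (d + e) (cart_prod G H)).
Proof.
move=> d0 polP gP polQ.
have finV : finite_set (vertices Q).
  have [B [_ [-> _ _]]] := polytope_generators polQ.
  apply: sub_finite_set (finite_seq B) => v /vertices_hull; exact: exposed_mem.
split=> [omega gH|d1 I omega finI _ gH].
  by apply: (product_polytopal d0 polP gP polQ finV _ _ gH) => //; right.
apply: (product_polytopal d0 polP gP polQ _ _ _ gH); last by left.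
  by rewrite finite_setU.
by move=> v; left.
Qed.
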